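(* Let $G$ be a finite non-abelian group, let $H$ be a subgroup of $G$ with $H \neq Z(H,G)$ and $|H| \notin \{2,3\}$, and let $g \in K(H,G)$. If $g \neq 1$, then $\Gamma_{H,G}^g$ is not a lollipop. Further, if $g \neq 1$ and $|H| \notin \{2,3,6\}$, then $\Gamma_{H,G}^g$ has no vertex of degree $1$.
   Context: For $x,y$ in a group, $[x,y] = x^{-1}y^{-1}xy$. For a subgroup $H$ of $G$: $Z(H,G) = \{x \in H : xy = yx \text{ for all } y \in G\}$ and $K(H,G) = \{[x,y] : x \in H,\ y \in G\}$. The relative $g$-noncommuting graph $\Gamma_{H,G}^g$ is the simple undirected graph with vertex set $G$ in which two distinct vertices $x,y$ are adjacent if and only if ($x \in H$ or $y \in H$) and $[x,y] \neq g$ and $[x,y] \neq g^{-1}$. A lollipop is a graph obtained from the disjoint union of a complete graph $K_m$ and a path $P_n$ on $n$ vertices ($m,n \geq 1$) by adding one edge joining a vertex of $K_m$ to an end vertex of $P_n$. *)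

(* Defs.v *)
From HB Require Import structures.
From mathcomp Require Import all_boot all_fingroup.

Set Implicit Arguments.
Unset Strict Implicit.
Unset Printing Implicit Defensive.

Local Open Scope group_scope.

Record sgraph := SGraph {
  svertex :> finType;
  sedge : rel svertex;
  sedge_sym : symmetric sedge;
  sedge_irr : irreflexive sedge
}.

Definition degree (A : sgraph) (x : A) : nat := #|[set y : A | sedge x y]|.

Definition isomorphic (A B : sgraph) : Prop :=
  exists f : A -> B, bijective f /\ forall x y, sedge (f x) (f y) = sedge x y.

Section Lollipop.
Variables (m n : nat) (k : 'I_m) (l : 'I_n).

(* K_m on 'I_m and the path 0 -- 1 -- ... -- n.-1 on 'I_n, with the extra edge
   k -- l; k and l being given, m and n are positive. *)
Definition lollipop_rel : rel ('I_m + 'I_n)%type := fun u v =>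
  match u, v with
  | inl i, inl j => i != j
  | inr i, inr j => (i.+1 == j :> nat) || (j.+1 == i :> nat)
  | inl i, inr j => (i == k) && (j == l)
  | inr j, inl i => (i == k) && (j == l)
  end.

Fact lollipop_rel_sym : symmetric lollipop_rel.
Proof. by case=> i [] j //=; [rewrite eq_sym | rewrite orbC]. Qed.

Fact lollipop_rel_irr : irreflexive lollipop_rel.
Proof. by case=> i /=; rewrite ?eqxx // orbb eqn_leq ltnn. Qed.

Definition lollipop : sgraph := SGraph lollipop_rel_sym lollipop_rel_irr.

End Lollipop.

Definition path_end n (l : 'I_n) : bool := (l == 0 :> nat) || (l == n.-1 :> nat).

Definition is_lollipop (A : sgraph) : Prop :=
  exists (m n : nat) (k : 'I_m) (l : 'I_n),
    path_end l /\ isomorphic A (lollipop k l).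

Section RelativeNoncommutingGraph.
Variables (gT : finGroupType) (G H : {group gT}) (g : gT).

Definition rel_noncomm_rel : rel [subg G] := fun x y =>
  [&& x != y, (sgval x \in H) || (sgval y \in H),
      [~ sgval x, sgval y] != g & [~ sgval x, sgval y] != g^-1].

Fact rel_noncomm_rel_sym : symmetric rel_noncomm_rel.
Proof.
move=> x y; rewrite /rel_noncomm_rel eq_sym orbC -(invg_comm (sgval y)).
by rewrite (inj_eq invg_inj) eqg_invLR [X in [&& _, _ & X]]andbC.
Qed.

Fact rel_noncomm_rel_irr : irreflexive rel_noncomm_rel.
Proof. by move=> x; rewrite /rel_noncomm_rel eqxx. Qed.

Definition rel_noncomm_graph : sgraph :=
  SGraph rel_noncomm_rel_sym rel_noncomm_rel_irr.

End RelativeNoncommutingGraph.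

(* Main.v *)
Require Import Defs.
From HB Require Import structures.
From mathcomp Require Import all_boot all_fingroup.
From mathcomp Require Import zify cyclic.

Set Implicit Arguments.
Unset Strict Implicit.
Unset Printing Implicit Defensive.

Local Open Scope group_scope.

(** Since [g != 1], the identity is adjacent to every other vertex, so a vertex
    [x] of degree 1, which is not 1 because [G] has more than two elements, has
    the identity as its only neighbour: [[x, y]] is [g] or [g^-1] for every
    [y] other than 1 and [x] such that [x] or [y] is in [H].

    If [x] is outside [H], this concerns all nontrivial [y] in [H].  In
    particular no nontrivial element of [H] commutes with [x], so that
    [y |-> [x, y]] is injective on [H] and [#|H| <= 3] ([degree1_mem]).  Hence
    [x] lies in [H], and the dichotomy concerns all [y] in [G] other than 1 and
    [x].  Then [x] is an involution inverting [g], and comparing [x] with [g]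
    itself gives [g ^+ 3 = 1] ([two_commg_inverting]).  Moreover the
    centraliser of [x] is [{1, x}] and its class is contained in
    [{x, xg, xg^-1}], so [#|G| = 6] ([two_commg_card]).  As a subgroup of such a
    [G] has order 1, 2, 3 or 6, this settles the second assertion.

    A lollipop always has a vertex of degree 1, namely the free end of its path.
    When [x] is such a vertex of the graph of [G], the identity is adjacent to
    the three involutions [x], [xg] and [xg^-1] (the transpositions, [G] being a
    copy of S_3), whose mutual commutators are all [g] or [g^-1]: they form a
    claw ([degree1_claw]).  But a lollipop is claw-free
    ([lollipop_claw_free]), as the neighbours of any vertex split into two
    cliques. *)

(** * Vertices of degree one and claws *)

Lemma degree1P (A : sgraph) (x : A) :
  degree x = 1%N <-> exists w, forall y, sedge x y = (y == w).
Proof.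
split=> [/eqP/cards1P[w Ew]|[w Ew]].
  by exists w => y; move/setP: Ew => /(_ y); rewrite !inE.
by apply/eqP/cards1P; exists w; apply/setP=> y; rewrite !inE.
Qed.

(** A claw is an induced complete bipartite graph K_{1,3}, centred here at [v]. *)
Definition has_claw (A : sgraph) : Prop :=
  exists v a b c : A,
    [/\ uniq [:: a; b; c], all (sedge v) [:: a; b; c]
      & [/\ ~~ sedge a b, ~~ sedge a c & ~~ sedge b c]].

Lemma isomorphic_degree1 (A B : sgraph) :
  isomorphic A B -> (exists v : B, degree v = 1%N) ->
  exists x : A, degree x = 1%N.
Proof.
case=> f [[h fK hK] fE] [v /degree1P[w Ew]].
exists (h v); apply/degree1P; exists (h w) => y.
by rewrite -fE hK Ew (can2_eq fK hK).
Qed.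

Lemma isomorphic_claw (A B : sgraph) :
  isomorphic A B -> has_claw A -> has_claw B.
Proof.
case=> f [[h fK _] fE] [v [a [b [c [Uabc Ev nE]]]]].
exists (f v), (f a), (f b), (f c); split; last by rewrite !fE.
  by rewrite -(map_inj_uniq (can_inj fK)) in Uabc.
by move: Ev; rewrite /= !fE.
Qed.

(** * Lollipops *)

(** The end of the path opposite to the one attached to the clique has degree 1;
    for a path on one vertex, that vertex itself, whose neighbour is then in the
    clique. *)
Lemma lollipop_degree1 m n (k : 'I_m) (l : 'I_n) :
  path_end l -> exists v : lollipop k l, degree v = 1%N.
Proof.
case: n l => [[]|n] l // end_l.
have [n0 | n_gt0] := posnP n.
  exists (inr l); apply/degree1P; exists (inl k : lollipop k l).
  case=> i /=; first by rewrite eqxx andbT.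
  by apply/negbTE; have := ltn_ord i; have := ltn_ord l; lia.
case: (eqVneq (l : nat) 0) => l0.
- have lt_n1: n.-1 < n.+1 by lia.
  exists (inr ord_max); apply/degree1P.
  exists (inr (Ordinal lt_n1) : lollipop k l) => -[] i /=; have := ltn_ord i.
    by rewrite andbC -val_eqE /= l0 (gtn_eqF n_gt0).
  have -> : (inr i == inr (Ordinal lt_n1) :> ('I_m + 'I_n.+1))
             = (i == n.-1 :> nat) by [].
  lia.
have ln: l = n :> nat by move: end_l; rewrite /path_end; lia.
have lt_1n: 1 < n.+1 by lia.
exists (inr ord0); apply/degree1P.
exists (inr (Ordinal lt_1n) : lollipop k l) => -[] i /=; have := ltn_ord i.
  by rewrite andbC -val_eqE /= ln (ltn_eqF n_gt0).
have -> : (inr i == inr (Ordinal lt_1n) :> ('I_m + 'I_n.+1))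
           = (i == 1%N :> nat) by [].
lia.
Qed.

(** A vertex of the clique has all its neighbours in the clique, except perhaps
    the attached end of the path; a vertex of the path has at most two
    neighbours, because the attachment is made at an end.  So two of any three
    neighbours of a vertex are adjacent. *)
Lemma lollipop_claw_free m n (k : 'I_m) (l : 'I_n) :
  path_end l -> ~ has_claw (lollipop k l).
Proof.
rewrite /path_end => end_l.
case=> v [a [b [c [/= Uabc /and4P[va vb vc _] [ab ac bc]]]]].
move: Uabc va vb vc ab ac bc.
have := ltn_ord l; move: end_l.
(* Each distribution of the four vertices between clique and path leaves a
   contradictory system of linear constraints on their indices. *)
case: v a b c => v [] a [] b [] c /=; rewrite ?inE /eq_op /= -?val_eqE /=;
  have := ltn_ord a; have := ltn_ord b; have := ltn_ord c; have := ltn_ord v;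
  lia.
Qed.

(** * Inverting an element of order three *)

Lemma commg_inverting (gT : finGroupType) (x g : gT) :
  g ^ x = g^-1 -> [~ x, x * g] = g * g.
Proof.
move=> gx; have -> : [~ x, x * g] = [~ x, g].
  by rewrite !commgEl conjgM (conjgE x x) mulKg.
by rewrite commgEr conjVg gx invgK.
Qed.

(** The model is S_3, with [x] a transposition and [g] a 3-cycle: then [x], [xg]
    and [xg^-1] are the three transpositions. *)
Section InvertedTranslates.

Variables (gT : finGroupType) (x g : gT).
Hypotheses (gx : g ^ x = g^-1) (g3 : g ^+ 3 = 1).

Let ggE : g * g = g^-1. Proof. by apply: (mulgI g); rewrite mulgV -g3. Qed.

Let ggVE : g^-1 * g^-1 = g. Proof. by rewrite -invgM ggE invgK. Qed.

Let gVx : g^-1 ^ x = g. Proof. by rewrite conjVg gx invgK. Qed.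

Lemma inverted_translates_uniq : g != 1 -> uniq [:: x; x * g; x * g^-1].
Proof.
move=> g1; rewrite /= !inE !negb_or andbT.
rewrite -{1 3}[x]mulg1 !(inj_eq (mulgI x)) ![1 == _]eq_sym invg_eq1 g1 /=.
by apply: contra_neq g1 => gV; apply: (mulgI g); rewrite ggE -gV mulg1.
Qed.

(** The translates [xg] and [xg^-1] are the conjugates of [x] by [g^-1]
    and [g]. *)
Lemma inverted_translates_nt : x != 1 -> x * g != 1 /\ x * g^-1 != 1.
Proof.
have -> : x * g = x ^ g^-1.
  by rewrite conjgE invgK mulgA (conjgC g) gx -mulgA ggVE.
have -> : x * g^-1 = x ^ g.
  by rewrite conjgE mulgA (conjgC g^-1) gVx -mulgA ggE.
by rewrite !conjg_eq1.
Qed.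

(** All three follow from [commg_inverting], because [x] inverts [g^-1] as well,
    [xg] inverts [g], and [xg^-1 = (xg)g]. *)
Lemma inverted_translates_commg :
  [/\ [~ x, x * g] = g^-1, [~ x, x * g^-1] = g & [~ x * g, x * g^-1] = g^-1].
Proof.
have gxg : g ^ (x * g) = g^-1 by rewrite conjgM gx conjVg (conjgE g g) mulKg.
have xgV : x * g^-1 = x * g * g by rewrite -mulgA ggE.
split; last rewrite xgV.
- by rewrite commg_inverting.
- by rewrite commg_inverting ?gVx ?invgK.
- by rewrite commg_inverting.
Qed.

End InvertedTranslates.

(** * Elements with only two nontrivial commutators *)

Lemma notin1_set2V (gT : finGroupType) (g : gT) :
  g != 1 -> 1 \notin [set g; g^-1].
Proof. by move=> g1; rewrite !inE ![1 == _]eq_sym invg_eq1 orbb. Qed.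

Section TwoCommutators.

Variables (gT : finGroupType) (G : {group gT}) (x g : gT).
Hypotheses (nabG : ~~ abelian G) (g1 : g != 1) (Gx : x \in G) (x1 : x != 1).
Hypothesis xG :
  forall y, y \in G -> y != 1 -> y != x -> [~ x, y] \in [set g; g^-1].

(** As [x] commutes with [x^-1], the latter cannot differ from [x].  Each
    commutator [[x, y]] is then the product of the involutions [x] and [x ^ y],
    hence is inverted by [x]; one of them is [g] or [g^-1].  Since
    [[x, y] = x] would give [x ^ y = 1], [g] differs from [x], so that
    [[x, g] = g * g] is [g] or [g^-1], and only the latter is possible. *)
Lemma two_commg_inverting :
  [/\ g \in G, x^-1 = x, g ^ x = g^-1 & g ^+ 3 = 1].
Proof.
have xV: x^-1 = x.
  apply: contraNeq (notin1_set2V g1) => xVx.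
  by have := @xG x^-1; rewrite groupV invg_eq1 commgVg; apply.
have [y Gy /norP[y1 yx]]: exists2 y, y \in G & ~~ ((y == 1) || (y == x)).
  apply/exists_inP; apply: contraR nabG; rewrite negb_exists_in => /forall_inP sG.
  apply: abelianS (cycle_abelian x); apply/subsetP=> y /sG.
  by rewrite negbK => /orP[] /eqP->; rewrite ?group1 ?cycle_id.
have xyx: [~ x, y] ^ x = [~ x, y]^-1.
  by rewrite commgEl invgM -conjVg invgK xV (conjgE _ x) -mulgA mulKg.
have xyg := xG Gy y1 yx.
have Gxy: [~ x, y] \in G by rewrite groupR.
have [Gg gx]: g \in G /\ g ^ x = g^-1.
  case/set2P: xyg xyx Gxy => ->; first by [].
  by rewrite groupV conjVg => /invg_inj.
have gNx: g != x.
  apply: contraNneq x1 => gx'; move: xyg.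
  rewrite gx' xV setUid inE commgEl.
  by rewrite (can2_eq (mulKVg x) (mulKg x)) -{3}xV mulgV conjg_eq1.
have := xG Gg g1 gNx; rewrite commgEr conjVg gx invgK.
case/set2P=> gg; last by split; rewrite // expgS expgS expg1 gg mulgV.
by case/eqP: g1; apply: (mulgI g); rewrite gg mulg1.
Qed.

(** The centraliser and the class of [x] give [#|G| = c * j] with [c <= 2] and
    [j <= 3], while [G] contains elements [x] of order 2 and [g] of order 3. *)
Lemma two_commg_card : #|G| = 6.
Proof.
have [Gg xV gx g3] := two_commg_inverting.
have xx: x ^+ 2 = 1 by rewrite expgS expg1 -{1}xV mulVg.
have ox: #[x] = 2 by apply: nt_prime_order.
have og: #[g] = 3 by apply: nt_prime_order.
have cardC: #|'C_G[x]| <= 2.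
  rewrite -ox; apply/subset_leq_card/subsetP=> y /setIP[Gy /cent1P xy].
  have [->|y1] := eqVneq y 1; first exact: group1.
  have [->|yx] := eqVneq y x; first exact: cycle_id.
  have := xG Gy y1 yx; have /commgP/eqP-> : commute x y by [].
  by rewrite (negPf (notin1_set2V g1)).
have cardJ: #|x ^: G| <= 3.
  apply: leq_trans (card_size [:: x; x * g; x * g^-1]).
  apply/subset_leq_card/subsetP=> _ /imsetP[y Gy ->].
  have [->|y1] := eqVneq y 1; first by rewrite conjg1 inE eqxx.
  have [->|yx] := eqVneq y x; first by rewrite conjgE mulKg inE eqxx.
  by have /set2P[] := xG Gy y1 yx => <-;
    rewrite commgEl mulKVg !inE eqxx ?orbT.
have := cardG_gt0 G; have := order_dvdG Gx; have := order_dvdG Gg; rewrite ox og.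
rewrite -(Lagrange (subsetIl G 'C[x])) index_cent1.
move: cardC cardJ; move: #|_| #|_| => c j.
by case: j => [|[|[|j]]] //; case: c => [|[|[|[|c]]]].
Qed.

End TwoCommutators.

(** * Vertices of degree one in the relative g-noncommuting graph *)

Section DegreeOne.

Variables (gT : finGroupType) (G H : {group gT}) (g : gT).
Hypotheses (nabG : ~~ abelian G) (sHG : H \subset G) (g1 : g != 1).

Let Gamma := rel_noncomm_graph G H g.

Lemma edge1 (x : Gamma) : sgval x != 1 -> sedge x (subg G 1).
Proof.
move=> x1; rewrite /= /rel_noncomm_rel -val_eqE /= subgK ?group1 // x1 orbT.
by rewrite commg1 ![1 == _]eq_sym invg_eq1 g1.
Qed.

(** If 1 has degree 1 then [G] has only one nontrivial element, hence is cyclic. *)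
Lemma degree1_nt (x : Gamma) : degree x = 1%N -> sgval x != 1.
Proof.
move=> /degree1P[w Ew]; apply: contra nabG => /eqP x1.
apply: abelianS (cycle_abelian (sgval w)); apply/subsetP=> y Gy.
have [->|y1] := eqVneq y 1; first exact: group1.
have xE : x = subg G 1 by apply: val_inj; rewrite /= subgK ?x1.
have := Ew (subg G y); rewrite sedge_sym xE edge1 ?subgK // => /esym/eqP <-.
by rewrite subgK ?cycle_id.
Qed.

(** Vertex 1 is the only neighbour of [x], so a [y] other than 1 and [x] can
    only fail to be adjacent to [x] because of its commutator with [x] once the
    condition on [H] holds. *)
Lemma degree1_commg (x : Gamma) (y : gT) :
    degree x = 1%N -> y \in G -> (sgval x \in H) || (y \in H) ->
    y != 1 -> y != sgval x -> [~ sgval x, y] \in [set g; g^-1].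
Proof.
move=> dx Gy xyH y1 yx.
have x1 := degree1_nt dx; have [w Ew] := (degree1P x).1 dx.
have w1: subg G 1 = w by apply/eqP; rewrite -Ew edge1.
have := Ew (subg G y); rewrite -w1 -val_eqE /= !subgK // (negPf y1).
rewrite /rel_noncomm_rel -val_eqE /= subgK // eq_sym yx xyH /= => /negbT.
by rewrite negb_and !negbK !inE.
Qed.

(** If [x] is not in [H], then [y |-> [x, y]] maps [H] minus 1 into [{g, g^-1}].
    It is injective: [[x, y] = [x, z]] makes [x] commute with [y * z^-1] in [H],
    which has to be trivial since 1 is neither [g] nor [g^-1]. *)
Lemma degree1_mem (x : Gamma) : 3 < #|H| -> degree x = 1%N -> sgval x \in H.
Proof.
move=> H4 dx; apply: contraLR H4 => xNH; rewrite -leqNgt (cardsD1 1) group1.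
rewrite ltnS -(@card_in_imset _ _ (fun y => [~ sgval x, y])) => [|y z].
  apply: leq_trans (_ : #|[set g; g^-1]| <= 2).
    apply/subset_leq_card/subsetP=> _ /imsetP[y /setD1P[y1 Hy] ->].
    apply: degree1_commg; rewrite ?(subsetP sHG) ?Hy ?orbT //.
    by apply: contraNneq xNH => <-.
  by rewrite cards2; case: eqP.
move=> /setD1P[y1 Hy] /setD1P[z1 Hz]; rewrite !commgEl => /mulgI xyz.
apply/eqP; rewrite eq_mulgV1; apply: contraNT g1 => yz1.
have: [~ sgval x, y * z^-1] \in [set g; g^-1].
  apply: degree1_commg; rewrite ?groupM ?groupV ?(subsetP sHG) ?orbT //.
  by apply: contraNneq xNH => <-; rewrite groupM ?groupV.
rewrite commgEl conjgM xyz conjgK mulVg.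
by apply: contraTT => /notin1_set2V.
Qed.

(** The claw consists of 1 and the three involutions [x], [xg], [xg^-1]. *)
Lemma degree1_claw (x : Gamma) :
  sgval x \in H -> degree x = 1%N -> has_claw Gamma.
Proof.
move=> Hx dx; have x1 := degree1_nt dx; have Gx := subsetP sHG _ Hx.
have [|Gg xV gx g3] := two_commg_inverting nabG g1 Gx x1.
  by move=> y Gy; apply: degree1_commg; rewrite ?Hx.
have edge_one (y : gT) : y \in G -> y != 1 ->
    @sedge Gamma (subg G 1) (subg G y).
  by move=> Gy y1; rewrite sedge_sym edge1 ?subgK.
have no_edge (y z : gT) : y \in G -> z \in G -> [~ y, z] \in [set g; g^-1] ->
    ~~ @sedge Gamma (subg G y) (subg G z).
  move=> Gy Gz; rewrite /= /rel_noncomm_rel !subgK // !inE.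
  by case/orP=> ->; rewrite ?andbF.
have Gxg : sgval x * g \in G by rewrite groupM.
have GxgV : sgval x * g^-1 \in G by rewrite groupM ?groupV.
have [xg1 xgV1] := inverted_translates_nt gx g3 x1.
have [c1 c2 c3] := inverted_translates_commg gx g3.
exists (subg G 1), (subg G (sgval x)).
exists (subg G (sgval x * g)), (subg G (sgval x * g^-1)).
split; last by rewrite !no_edge ?c1 ?c2 ?c3 ?set21 ?set22.
  have subgI (y z : gT) : y \in G -> z \in G ->
    (subg G y == subg G z) = (y == z).
    by move=> Gy Gz; rewrite -val_eqE /= !subgK.
  by have := inverted_translates_uniq (sgval x) g3 g1; rewrite /= !inE !subgI.
by rewrite /all !edge_one.
Qed.

End DegreeOne.

Theorem theorem2p6 (gT : finGroupType) (G H : {group gT}) (g : gT) :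
  ~~ abelian G ->
  H \subset G ->
  H <> 'C_H(G) :> {set gT} ->
  #|H| \notin [:: 2; 3] ->
  g \in commg_set H G ->
  (g != 1 -> ~ is_lollipop (rel_noncomm_graph G H g)) /\
  (g != 1 -> #|H| \notin [:: 2; 3; 6] ->
   ~ exists x : rel_noncomm_graph G H g, degree x = 1%N).
Proof.
move=> nabG sHG HnC H23 _.
have H1: #|H| <> 1%N.
  by move/eqP; rewrite -trivg_card1 => /eqP H1; case: HnC; rewrite H1 setI1g.
have H4: 3 < #|H|.
  by move: H23 H1 (cardG_gt0 H); rewrite !inE; case: #|H| => [|[|[|[]]]].
split=> [g1 [m [n [k [l [end_l iso]]]]] | g1 H6 [x dx]].
  have [x dx] := isomorphic_degree1 iso (lollipop_degree1 k end_l).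
  have Hx := degree1_mem nabG sHG g1 H4 dx.
  apply: (lollipop_claw_free end_l); apply: (isomorphic_claw iso).
  exact: (degree1_claw nabG sHG g1 Hx dx).
have Hx := degree1_mem nabG sHG g1 H4 dx.
have oG: #|G| = 6.
  apply: (two_commg_card nabG g1 (subsetP sHG _ Hx)).
    exact: (degree1_nt nabG g1 dx).
  by move=> y Gy; apply: degree1_commg; rewrite ?Hx.
have: #|H| \in divisors 6 by rewrite -dvdn_divisors // -oG cardSg.
have -> : divisors 6 = [:: 1; 2; 3; 6]%N by [].
by rewrite in_cons (negPf H6) orbF => /eqP.
Qed.
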